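(* Let $A,X,R,D,Y$ be discrete random variables with ranges $\mathcal{A},\mathcal{X},\mathcal{R},\mathcal{D},\mathcal{Y}$ (with $\mathcal{Y}\subseteq\mathbb{R}$), where $R$ is a deterministic function of $(A,X)$. For each $d\in\mathcal{D}$ let $Y^d$ be a $\mathcal{Y}$-valued random variable (the potential outcome under $d$). Let $P_{\text{pre}}$ and $P_{\text{post}}$ be two probability distributions governing all these variables jointly. Suppose the following conditions hold. 1. (Consistency) Under both $P_{\text{pre}}$ and $P_{\text{post}}$, $Y=\sum_{d\in\mathcal{D}}Y^d\,\mathbf{1}[D=d]$. 2. (Unconfoundedness) For each $t\in\{\text{pre},\text{post}\}$ and each $d\in\mathcal{D}$, $Y^d$ is conditionally independent of $D$ given $(A,X)$ under $P_t$. 3. (No Unprecedented Decisions) For all $a'\in\mathcal{A}$, $x\in\mathcal{X}$, $d\in\mathcal{D}$: if $P_{\text{post}}(D=d\mid A=a',X=x)>0$, then $P_{\text{pre}}(D=d\mid A=a',X=x)>0$. 4. (Stable CATE) For all $a'\in\mathcal{A}$, $x\in\mathcal{X}$, $d\in\mathcal{D}$, the conditional distribution of $Y^d$ given $A=a',X=x$ is the same under both measures: $P_{\text{pre}}(Y^d=y'\mid A=a',X=x)=P_{\text{post}}(Y^d=y'\mid A=a',X=x)$ for all $y'\in\mathcal{Y}$. 5. (No Feedback) For all $a'\in\mathcal{A}$, $x\in\mathcal{X}$: $P_{\text{pre}}(A=a',X=x)=P_{\text{post}}(A=a',X=x)$. Let $a\in\mathcal{A}$ satisfy $P_{\text{post}}(A=a)>0$,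 and let $y\in\mathcal{Y}$. Then $$P_{\text{post}}(Y=y\mid A=a)=\sum_{(x,d)\in\Pi_{\text{post}}}P_{\text{pre}}(Y=y\mid A=a,X=x,D=d)\,P_{\text{pre}}(X=x\mid A=a)\,P_{\text{post}}(D=d\mid A=a,X=x),$$ where $\Pi_{\text{post}}=\{(x,d)\in\mathcal{X}\times\mathcal{D}: P_{\text{post}}(X=x,D=d\mid A=a)>0\}$.
   Context: Interpretation: $A$ is a sensitive attribute, $X$ covariates, $R$ a risk score, $D$ a decision, $Y$ an observed outcome; $P_{\text{pre}}$ and $P_{\text{post}}$ are the joint distributions before and after deployment of an algorithmic policy. ''Discrete'' means taking values in a countable set. $\mathbf{1}[\cdot]$ denotes the indicator function. Conditional probabilities are the elementary ones, $P(E\mid F)=P(E\cap F)/P(F)$ for $P(F)>0$; the conditions Unconfoundedness, No Unprecedented Decisions and Stable CATE are required for those values $(a',x)$ of $(A,X)$ for which the conditioning event $\{A=a',X=x\}$ has positive probability under the relevant measure(s). Unconfoundedness means: for each such $(a',x)$ and all $y'\in\mathcal{Y}$, $d,d'\in\mathcal{D}$, $P_t(Y^d=y',D=d'\mid A=a',X=x)=P_t(Y^d=y'\mid A=a',X=x)\,P_t(D=d'\mid A=a',X=x)$. The set $\Pi_{\text{post}}$ depends on $a$. *)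

(* Defs.v *)
From HB Require Import structures.
From mathcomp Require Import all_boot all_order all_algebra.
From mathcomp Require Import all_classical all_reals all_analysis.

Set Implicit Arguments.
Unset Strict Implicit.
Unset Printing Implicit Defensive.

Import Order.TTheory GRing.Theory Num.Theory.

Local Open Scope classical_set_scope.
Local Open Scope ring_scope.

(* Elementary conditional probability P(E | F); it takes the junk value 0 when
   P F = 0, so every hypothesis below that conditions on an event carries an
   explicit positivity guard. *)
Definition cprob {d} {T : measurableType d} {R : realType}
    (P : probability T R) (E F : set T) : R :=
  fine (P (E `&` F)) / fine (P F).

Section causal_conditions.
Context {dO dA dX dD : measure_display} {Omega : measurableType dO}
  {TA : measurableType dA} {TX : measurableType dX} {TD : measurableType dD}
  {R : realType}.

(* Yp d is the potential outcome Y^d, for d in calD; its values at other d are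
   never used. *)
Implicit Types (P Ppre Ppost : probability Omega R)
  (calA : set TA) (calX : set TX) (calD : set TD) (calY : set R)
  (A : Omega -> TA) (X : Omega -> TX) (D : Omega -> TD) (Y : Omega -> R)
  (Yp : TD -> Omega -> R).

(* At each w at most one term of the sum is nonzero, so the finite-support sum
   over calD is the full sum. *)
Definition consistency P calD D Y Yp : Prop :=
  {ae P, forall w,
    Y w = \sum_(d \in calD) Yp d w * \1_[set w' | D w' = d] w}.

Definition unconfoundedness P calA calX calD calY A X D Yp : Prop :=
  forall d, calD d ->
  forall a' x, calA a' -> calX x ->
    (0 < P [set w | A w = a' /\ X w = x])%E ->
  forall y' d', calY y' -> calD d' ->
    cprob P [set w | Yp d w = y' /\ D w = d'] [set w | A w = a' /\ X w = x] =
    cprob P [set w | Yp d w = y'] [set w | A w = a' /\ X w = x] *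
    cprob P [set w | D w = d'] [set w | A w = a' /\ X w = x].

Definition no_unprecedented_decisions Ppre Ppost calA calX calD A X D : Prop :=
  forall a' x d, calA a' -> calX x -> calD d ->
    (0 < Ppre [set w | A w = a' /\ X w = x])%E ->
    (0 < Ppost [set w | A w = a' /\ X w = x])%E ->
    0 < cprob Ppost [set w | D w = d] [set w | A w = a' /\ X w = x] ->
    0 < cprob Ppre [set w | D w = d] [set w | A w = a' /\ X w = x].

Definition stable_cate Ppre Ppost calA calX calD calY A X Yp : Prop :=
  forall a' x d, calA a' -> calX x -> calD d ->
    (0 < Ppre [set w | A w = a' /\ X w = x])%E ->
    (0 < Ppost [set w | A w = a' /\ X w = x])%E ->
  forall y', calY y' ->
    cprob Ppre [set w | Yp d w = y'] [set w | A w = a' /\ X w = x] =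
    cprob Ppost [set w | Yp d w = y'] [set w | A w = a' /\ X w = x].

Definition no_feedback Ppre Ppost calA calX A X : Prop :=
  forall a' x, calA a' -> calX x ->
    Ppre [set w | A w = a' /\ X w = x] = Ppost [set w | A w = a' /\ X w = x].

Definition Pi_post Ppost calX calD A X D (a : TA) : set (TX * TD) :=
  [set xd | [/\ calX xd.1, calD xd.2 &
    0 < cprob Ppost [set w | X w = xd.1 /\ D w = xd.2] [set w | A w = a]]].

End causal_conditions.

(* Main.v *)
Require Import Defs.
From HB Require Import structures.
From mathcomp Require Import all_boot all_order all_algebra.
From mathcomp Require Import all_classical all_reals all_analysis.
From mathcomp Require Import ring.

Import Order.TTheory GRing.Theory Num.Theory.

Local Open Scope classical_set_scope.
Local Open Scope ring_scope.

(* Split {Y = y, A = a} along the strata (X, D) = (x, d).  By consistency and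
   unconfoundedness, P(Y = y | a, x, d) = P(Y^d = y | a, x) under either measure,
   and the right-hand side is common to both by Stable CATE.  No Feedback,
   summed over x, also identifies P_pre(A = a) with P_post(A = a), so each
   stratum contributes exactly the corresponding summand; strata outside Pi_post
   are P_post-null, and No Unprecedented Decisions makes the conditioning
   event P_pre-positive on the others. *)

Lemma measurable_fiber d d' (T : measurableType d) (T' : measurableType d')
    (f : T -> T') (u : T') :
  measurable_fun setT f -> measurable [set u] -> measurable [set w | f w = u].
Proof. by move=> mf mu; have := mf measurableT _ mu; rewrite setTI. Qed.

(** Countability of [B] supplies a map [f] to the naturals that is injective on [B]; countable
    additivity is applied to the fibers of [f] after [Z], and the sum is then reindexed along
    [f]. *)
Lemma measure_esum_fibers d (T : measurableType d) (R : realType)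
    (mu : {measure set T -> \bar R}) (I : choiceType) (B : set I)
    (Z : T -> I) (E : set T) :
  countable B -> E `<=` Z @^-1` B ->
  (forall i, B i -> measurable (E `&` [set w | Z w = i])) ->
  mu E = \esum_(i in B) mu (E `&` [set w | Z w = i]).
Proof.
move=> /countable_injP[f finj] EB mE.
(* Points of [E] have their [Z]-value in [B], where [f] is injective, so composing with [f] merges
   no fibers inside [E]. *)
have fibE i : B i ->
    E `&` [set w | f (Z w) = f i] = E `&` [set w | Z w = i].
  move=> Bi; apply/seteqP; split => w [Ew /= e]; split => //=; last by rewrite e.
  by apply: finj; rewrite ?inE//; exact: EB.
under eq_esum => i Bi do rewrite -fibE//.
rewrite -(esum_image _ f (fun n => mu (E `&` [set w | f (Z w) = n]))); last first.
  by move=> i j iB jB; exact: finj.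
have -> : mu E = mu (\bigcup_(n in f @` B) (E `&` [set w | f (Z w) = n])).
  congr (mu _); apply/seteqP; split => [w Ew|w [n _ []]//].
  by exists (f (Z w)) => //; exists (Z w) => //; exact: EB.
rewrite measure_bigcup.
- by rewrite nneseries_esum// set_mem_set.
- by move=> _ [i Bi <-]; rewrite fibE//; exact: mE.
- by move=> m n _ _ [w [[_ /= <-] [_ /= <-]]].
Qed.

(** The exceptional points lie in a null set [N]; removing [N] changes neither measure, and what
    remains of [S] and [S'] is the same set. This is how almost sure consistency enters an equality
    of probabilities. *)
Lemma eq_measure_ae d (T : measurableType d) (R : realType)
    (mu : {measure set T -> \bar R}) (S S' : set T) :
  measurable S -> measurable S' -> {ae mu, forall w, S w <-> S' w} ->
  mu S = mu S'.
Proof.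
move=> mS mS' [N [mN N0 SN]].
have offN U : measurable U -> mu U = mu (U `\` N).
  move=> mU; have UN0 : mu (U `&` N) = 0%E.
    apply: (subset_measure0 _ _ _ N0) => //; exact: measurableI.
  transitivity (mu (U `\` N) + mu (U `&` N))%E; first exact: measureDI.
  by rewrite UN0 adde0.
rewrite (offN S)// (offN S')//.
congr (mu _); apply/seteqP; split => w [Sw Nw]; split => //.
  by apply: contrapT => S'w; apply/Nw/SN => -[SS' _]; exact/S'w/SS'.
by apply: contrapT => S'w; apply/Nw/SN => -[_ SS']; exact/S'w/SS'.
Qed.

Section strata.
Context {dO dA dX dD : measure_display} {Omega : measurableType dO}
  {TA : measurableType dA} {TX : measurableType dX} {TD : measurableType dD}
  {R : realType}.
Variables (P : probability Omega R)
  (calA : set TA) (calX : set TX) (calD : set TD) (calY : set R)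
  (A : Omega -> TA) (X : Omega -> TX) (D : Omega -> TD) (Y : Omega -> R)
  (Yp : TD -> Omega -> R).

(** In the consistency sum every indicator vanishes except the one at [d = D w]. *)
Lemma consistency_ae : consistency P calD D Y Yp ->
  {ae P, forall w, calD (D w) -> Y w = Yp (D w) w}.
Proof.
apply: filterS => w Yw Dw; rewrite Yw -(fsbig_widen [set D w])/=.
- by rewrite fsbig_set1 indicE mem_set// mulr1.
- by move=> _ ->.
- by move=> d [_ /= neD]; rewrite indicE memNset ?mulr0// => /esym.
Qed.

(* The identity P(Y = y | a, x, d) = P(Y^d = y | a, x), multiplied out so that
   P(a, x, d) = 0 is allowed. *)
Lemma stratum_outcome (a : TA) (x : TX) (d : TD) (y : R) :
  measurable [set w | A w = a /\ X w = x] -> measurable [set w | D w = d] ->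
  measurable [set w | Y w = y] -> measurable [set w | Yp d w = y] ->
  calA a -> calX x -> calD d -> calY y ->
  consistency P calD D Y Yp ->
  unconfoundedness P calA calX calD calY A X D Yp ->
  (0 < P [set w | A w = a /\ X w = x])%E ->
  fine (P ([set w | Y w = y] `&` [set w | [/\ A w = a, X w = x & D w = d]])) =
  cprob P [set w | Yp d w = y] [set w | A w = a /\ X w = x] *
  fine (P [set w | [/\ A w = a, X w = x & D w = d]]).
Proof.
set F := [set w | A w = a /\ X w = x].
move=> mF mD mY mYd aA xX Dd yY cons unconf F0.
have GE : [set w | [/\ A w = a, X w = x & D w = d]] = [set w | D w = d] `&` F.
  by apply/seteqP; split => [w []//|w [? []]].
have mDF : measurable ([set w | D w = d] `&` F) by exact: measurableI.
have YE : P ([set w | Y w = y] `&` ([set w | D w = d] `&` F)) =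
          P ([set w | Yp d w = y /\ D w = d] `&` F).
  rewrite (_ : [set w | Yp d w = y /\ D w = d] `&` F =
    [set w | Yp d w = y] `&` ([set w | D w = d] `&` F)); last by rewrite setIA.
  apply: eq_measure_ae; [exact: measurableI..|].
  apply: filterS (consistency_ae cons) => w Yw.
  by split=> -[/= Yy [/= Dw Fw]]; split => //=; move: Yw; rewrite Dw Yy => ->.
have pF0 : fine (P F) != 0.
  by rewrite gt_eqF// fine_gt0// F0/= ltey_eq fin_num_measure.
(* Multiplying unconfoundedness by [P F] cancels one division on each side, which leaves the stratum
   probability as a factor and never as a divisor. *)
rewrite GE YE; have /(congr1 ( *%R^~ (fine (P F)))) :=
  unconf d Dd a x aA xX F0 y d yY Dd.
by rewrite /cprob -/F !mulrA !divfK.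
Qed.

End strata.

Theorem theorem1 (R : realType) (dO dA dX dS dD : measure_display)
  (Omega : measurableType dO)
  (TA : measurableType dA) (TX : measurableType dX)
  (TS : measurableType dS) (TD : measurableType dD)
  (mTA : forall u : TA, measurable [set u])
  (mTX : forall u : TX, measurable [set u])
  (mTS : forall u : TS, measurable [set u])
  (mTD : forall u : TD, measurable [set u])
  (calA : set TA) (calX : set TX) (calR : set TS) (calD : set TD)
  (calY : set R)
  (cA : countable calA) (cX : countable calX) (cR : countable calR)
  (cD : countable calD) (cY : countable calY)
  (A : {dmfun Omega >-> TA}) (X : {dmfun Omega >-> TX})
  (Risk : {dmfun Omega >-> TS}) (D : {dmfun Omega >-> TD})
  (Y : {dmfun Omega >-> R}) (Yp : TD -> {dmfun Omega >-> R})
  (rA : range A `<=` calA) (rX : range X `<=` calX)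
  (rR : range Risk `<=` calR) (rD : range D `<=` calD)
  (rY : range Y `<=` calY)
  (rYp : forall d, calD d -> range (Yp d) `<=` calY)
  (Risk_det : exists r : TA -> TX -> TS, forall w, Risk w = r (A w) (X w))
  (Ppre Ppost : probability Omega R)
  (consistency_pre : consistency Ppre calD D Y Yp)
  (consistency_post : consistency Ppost calD D Y Yp)
  (unconf_pre : unconfoundedness Ppre calA calX calD calY A X D Yp)
  (unconf_post : unconfoundedness Ppost calA calX calD calY A X D Yp)
  (nud : no_unprecedented_decisions Ppre Ppost calA calX calD A X D)
  (cate : stable_cate Ppre Ppost calA calX calD calY A X Yp)
  (nofb : no_feedback Ppre Ppost calA calX A X)
  (a : TA) (aA : calA a) (Pa : (0 < Ppost [set w | A w = a])%E)
  (y : R) (yY : calY y) :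
  (cprob Ppost [set w | Y w = y] [set w | A w = a])%:E =
  (\esum_(xd in Pi_post Ppost calX calD A X D a)
    (cprob Ppre [set w | Y w = y]
       [set w | [/\ A w = a, X w = xd.1 & D w = xd.2]] *
     cprob Ppre [set w | X w = xd.1] [set w | A w = a] *
     cprob Ppost [set w | D w = xd.2]
       [set w | A w = a /\ X w = xd.1])%:E)%E.
Proof.
have mA := measurable_fiber _ _ _ _ A _ (measurable_funPT A) (mTA a).
have mX x := measurable_fiber _ _ _ _ X _ (measurable_funPT X) (mTX x).
have mD d := measurable_fiber _ _ _ _ D _ (measurable_funPT D) (mTD d).
have mY := measurable_fiber _ _ _ _ Y y (measurable_funPT Y) (measurable_set1 _).
have mYp d :=
  measurable_fiber _ _ _ _ (Yp d) y (measurable_funPT _) (measurable_set1 _).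
have mAX x : measurable [set w | A w = a /\ X w = x] by exact: (measurableI _ _ mA (mX x)).
have calAX x w : X w = x -> calX x by move=> <-; apply: rX; exists w.
have preA : Ppre [set w | A w = a] = Ppost [set w | A w = a].
  rewrite (measure_esum_fibers _ _ _ _ _ calX X)//; last first.
  - by move=> x _; exact: mAX.
  - by move=> w _; exact: calAX.
  rewrite [RHS](measure_esum_fibers _ _ _ _ _ calX X)//; last first.
  - by move=> x _; exact: mAX.
  - by move=> w _; exact: calAX.
  by apply: eq_esum => x xX; exact: nofb.
set E := [set w | A w = a] in mA preA Pa *.
have pE0 : 0 < fine (Ppost E) by rewrite fine_gt0// Pa/= ltey_eq fin_num_measure.
have GE x d : [set w | [/\ A w = a, X w = x & D w = d]] =
    [set w | D w = d] `&` [set w | A w = a /\ X w = x].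
  by apply/seteqP; split => [w []//|w [? []]].
have mG x d : measurable [set w | [/\ A w = a, X w = x & D w = d]].
  by rewrite GE; exact: measurableI.
(* Conditioning on [E] is written as scaling the measure [Ppost] by [1 / Ppost E], so that the
   decomposition along fibers applies to the conditional probability directly, with no constant to
   move through the sum. *)
have c0 : 0 <= (fine (Ppost E))^-1 by rewrite invr_ge0 ltW.
have YE : (cprob Ppost [set w | Y w = y] E)%:E =
    mscale (NngNum c0) Ppost ([set w | Y w = y] `&` E).
  rewrite /mscale/= /cprob -[X in (_ * X)%E]fineK ?fin_num_measure//; last first.
    exact: measurableI.
  by rewrite -EFinM mulrC.
have termE x d : [set w | Y w = y] `&` E `&` [set w | (X w, D w) = (x, d)] =
    [set w | Y w = y] `&` [set w | [/\ A w = a, X w = x & D w = d]].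
  by apply/seteqP; split => [w [[? ?] [? ?]]//|w [? [? /= <- <-]]].
have mT x d : measurable
    ([set w | Y w = y] `&` E `&` [set w | (X w, D w) = (x, d)]).
  by rewrite termE; exact: measurableI.
rewrite YE (measure_esum_fibers _ _ _ _ _ (calX `*` calD) (fun w => (X w, D w)));
  last 3 first.
- exact: countableX.
- by move=> w _; split => /=; [apply: rX|apply: rD]; exists w.
- by move=> [x d] _; exact: mT.
(* As [Ppost E > 0], conditional positivity amounts to joint positivity. In this form the sum over
   [Pi_post] becomes one over all of [calX * calD] with zero terms elsewhere, and the two sides can
   be compared term by term. *)
have PiE : Pi_post Ppost calX calD A X D a = (calX `*` calD) `&`
    [set xd | 0 < fine (Ppost [set w | [/\ A w = a, X w = xd.1 & D w = xd.2]])].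
  have e x d : [set w | X w = x /\ D w = d] `&` E =
      [set w | [/\ A w = a, X w = x & D w = d]].
    by apply/seteqP; split => [w [[]]//|w []].
  apply/seteqP; split => -[x d] ; rewrite /Pi_post /cprob /= -/E e.
    by move=> [xX Dd]; rewrite pmulr_lgt0 ?invr_gt0.
  by move=> [[xX Dd] ?]; split => //; rewrite pmulr_lgt0 ?invr_gt0.
rewrite PiE [RHS]esum_mkcondr; apply: eq_esum => -[x d] [/= xX Dd].
rewrite /mscale/= termE.
case: ifPn; rewrite (inE, notin_setE)/= => G0; last first.
  have G1 : Ppost [set w | [/\ A w = a, X w = x & D w = d]] = 0%E.
    apply/eqP; rewrite -fine_eq0 ?fin_num_measure// eq_le leNgt.
    by apply/andP; split; [apply/negP|rewrite fine_ge0].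
  rewrite [X in (_ * X)%E](subset_measure0 _ _ _ G1) ?mule0//.
  exact: measurableI.
have F0 : (0 < Ppost [set w | A w = a /\ X w = x])%E.
  apply: (@lt_le_trans _ _ (Ppost [set w | [/\ A w = a, X w = x & D w = d]])).
    by rewrite -[X in (_ < X)%E]fineK ?fin_num_measure ?lte_fin.
  by apply: le_measure; rewrite ?inE; [exact: mG|exact: mAX|move=> w []].
have F0' : (0 < Ppre [set w | A w = a /\ X w = x])%E by rewrite nofb.
have pF0 : 0 < fine (Ppost [set w | A w = a /\ X w = x]).
  by rewrite fine_gt0// F0/= ltey_eq fin_num_measure.
(* Both denominators are positive, so this transfers positivity of the whole stratum from [Ppost] to
   [Ppre]. *)
have := nud a x d aA xX Dd F0' F0.
rewrite /cprob -GE nofb// !pmulr_lgt0 ?invr_gt0// => /(_ G0) G0'.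
have -> : [set w | X w = x] `&` E = [set w | A w = a /\ X w = x].
  by rewrite setIC.
rewrite -[X in (_ * X)%E]fineK ?fin_num_measure//; last exact: measurableI.
rewrite -EFinM; congr EFin.
rewrite (stratum_outcome Ppost calA calX calD calY _ _ _ _ Yp)//.
rewrite (stratum_outcome Ppre calA calX calD calY _ _ _ _ Yp)//.
(* [mulfK] cancels the [Ppre] probability of the stratum, nonzero by [G0']; what is left for [field]
   divides only by the [Ppost] probabilities of [A = a] and of [A = a, X = x]. *)
rewrite (cate a x d) // preA nofb// mulfK ?gt_eqF//.
by field; rewrite !gt_eqF.
Qed.
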